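(* Let $\mu,L,M>0$ and let $f:\mathbb{R}^n\to\mathbb{R}$ be three times continuously differentiable, $\mu$-strongly convex, with $L$-Lipschitz continuous gradient, and $M$-self-concordant. Let $\varkappa=L/\mu$, let $\mathbf{x}_*$ be the unique minimizer of $f$, let $\mathbf{x}_0\in\mathbb{R}^n$, let $\mathbf{B}_0\in\mathbb{R}^{n\times n}$ be symmetric positive definite, and let $(\mathbf{x}_k)_{k\ge 0}$ be generated by the adaptive BFGS algorithm with parameter $M$ (with $\nabla f(\mathbf{x}_k)\neq\mathbf{0}$ for all $k$). Put $\Delta=f(\mathbf{x}_0)-f(\mathbf{x}_* )$, $\bar{\mathbf{B}}_0=\mathbf{B}_0/L$, $K_1=4M^2\Delta$, $K_2=4\sqrt{2\varkappa}\,M\sqrt{\Delta}$ and $$K_3=\frac{\min\{(2\ln\varkappa+1)K_1,\;2\sqrt{\varkappa}K_2\}}{\min\{2\ln\varkappa+1,\;2\}}.$$ Then for all integers $k\ge 2\Psi(\bar{\mathbf{B}}_0)+\min\{(2\ln\varkappa+1)K_1,\;2\sqrt{\varkappa}K_2\}$, $$\frac{f(\mathbf{x}_k)-f(\mathbf{x}_* )}{f(\mathbf{x}_0)-f(\mathbf{x}_* )}\le\Bigl(1-\frac{1}{6\varkappa}\Bigr)^{k-K_3}.$$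
   Context: $\|\cdot\|$ is the Euclidean norm for vectors, and $\|\mathbf{d}\|_{\mathbf{x}}=(\mathbf{d}^\top\nabla^2 f(\mathbf{x})\mathbf{d})^{1/2}$. The function $f$ is $\mu$-strongly convex if $f(\lambda\mathbf{x}+(1-\lambda)\mathbf{y})\le\lambda f(\mathbf{x})+(1-\lambda)f(\mathbf{y})-\frac{\lambda(1-\lambda)\mu}{2}\|\mathbf{x}-\mathbf{y}\|^2$ for all $\mathbf{x},\mathbf{y}\in\mathbb{R}^n$, $\lambda\in[0,1]$. It has $L$-Lipschitz gradient if $\|\nabla f(\mathbf{x})-\nabla f(\mathbf{y})\|\le L\|\mathbf{x}-\mathbf{y}\|$ for all $\mathbf{x},\mathbf{y}$. A convex $f$ is $M$-self-concordant if $|\nabla^3 f(\mathbf{x})[\mathbf{d},\mathbf{d},\mathbf{d}]|\le 2M\|\mathbf{d}\|_{\mathbf{x}}^3$ for all $\mathbf{x},\mathbf{d}$. For a symmetric positive definite $n\times n$ matrix $\mathbf{A}$, $\Psi(\mathbf{A})=\mathrm{Tr}(\mathbf{A})-\ln\det(\mathbf{A})-n$. Adaptive BFGS algorithm: for $k=0,1,2,\dots$ set $\mathbf{g}_k=\nabla f(\mathbf{x}_k)$, $\mathbf{d}_k=-\mathbf{B}_k^{-1}\mathbf{g}_k$, $$t_k=-\frac{\mathbf{g}_k^\top\mathbf{d}_k}{\|\mathbf{d}_k\|_{\mathbf{x}_k}\bigl(\|\mathbf{d}_k\|_{\mathbf{x}_k}-M\mathbf{g}_k^\top\mathbf{d}_k\bigr)},$$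 $\mathbf{x}_{k+1}=\mathbf{x}_k+t_k\mathbf{d}_k$, $\mathbf{s}_k=t_k\mathbf{d}_k$, $\mathbf{y}_k=\nabla f(\mathbf{x}_{k+1})-\nabla f(\mathbf{x}_k)$, and $$\mathbf{B}_{k+1}=\mathbf{B}_k-\frac{\mathbf{B}_k\mathbf{s}_k\mathbf{s}_k^\top\mathbf{B}_k}{\mathbf{s}_k^\top\mathbf{B}_k\mathbf{s}_k}+\frac{\mathbf{y}_k\mathbf{y}_k^\top}{\mathbf{y}_k^\top\mathbf{s}_k}.$$ *)

(* Defs.v *)
From mathcomp Require Import all_boot all_order all_algebra.
From mathcomp Require Import all_classical all_reals all_analysis.

Set Implicit Arguments.
Unset Strict Implicit.
Unset Printing Implicit Defensive.

Import Order.TTheory GRing.Theory Num.Theory.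
Import numFieldNormedType.Exports.

Local Open Scope classical_set_scope.
Local Open Scope ring_scope.

Section Vectors.
Context {R : realType} {n : nat}.
Implicit Types (u v : 'cV[R]_n) (A : 'M[R]_n).

Definition dotv u v : R := (u^T *m v) 0 0.

(* The library norm on matrices is the sup norm, hence this definition; both
   norms induce the same topology and the same notion of differentiability. *)
Definition enorm v : R := Num.sqrt (dotv v v).

Definition posdef A : Prop :=
  A^T = A /\ forall v, v != 0 -> 0 < dotv v (A *m v).

Definition Psi A : R := \tr A - ln (\det A) - n%:R.

End Vectors.

Section Calculus.
Context {R : realType} {n : nat}.
Implicit Types (f : 'cV[R]_n -> R) (x d : 'cV[R]_n).

Definition partial (i : 'I_n) f : 'cV[R]_n -> R :=
  fun x => 'D_(delta_mx i 0) f x.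

(* The partial derivatives are the coordinates of the differential, so that
   this says that the differential of f exists and is of class C^k. *)
Fixpoint Ck (k : nat) f : Prop :=
  if k is k'.+1 then (forall x, differentiable f x) /\
                     (forall i, Ck k' (partial i f))
  else continuous f.

Definition grad f x : 'cV[R]_n := \col_i partial i f x.

Definition hess f x : 'M[R]_n := \matrix_(i, j) partial i (partial j f) x.

Definition third f x d : R :=
  \sum_(i < n) \sum_(j < n) \sum_(k < n)
    partial i (partial j (partial k f)) x * d i 0 * d j 0 * d k 0.

Definition hnorm f x d : R := Num.sqrt (dotv d (hess f x *m d)).

Definition strongly_convex (mu : R) f : Prop :=
  forall (x y : 'cV[R]_n) (lam : R), 0 <= lam <= 1 ->
    f (lam *: x + (1 - lam) *: y) <=
      lam * f x + (1 - lam) * f y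
      - lam * (1 - lam) * mu / 2 * enorm (x - y) ^+ 2.

Definition lipschitz_grad (L : R) f : Prop :=
  forall x y : 'cV[R]_n, enorm (grad f x - grad f y) <= L * enorm (x - y).

Definition self_concordant (M : R) f : Prop :=
  convex_function [set: 'cV[R]_n] f /\
  forall x d, `|third f x d| <= 2 * M * hnorm f x d ^+ 3.

End Calculus.

Section AdaptiveBFGS.
Context {R : realType} {n : nat}.
Variables (M : R) (f : 'cV[R]_n -> R).

Definition bfgs_dir (x : 'cV[R]_n) (B : 'M[R]_n) : 'cV[R]_n :=
  - (invmx B *m grad f x).

Definition adaptive_step (x d : 'cV[R]_n) : R :=
  let gd := dotv (grad f x) d in
  let delta := hnorm f x d in
  - (gd / (delta * (delta - M * gd))).

Definition bfgs_update (B : 'M[R]_n) (s y : 'cV[R]_n) : 'M[R]_n :=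
  B - (dotv s (B *m s))^-1 *: (B *m s *m s^T *m B)
    + (dotv y s)^-1 *: (y *m y^T).

Definition adaptive_BFGS (x0 : 'cV[R]_n) (B0 : 'M[R]_n)
    (x : nat -> 'cV[R]_n) (B : nat -> 'M[R]_n) : Prop :=
  [/\ x 0%N = x0, B 0%N = B0 &
    forall k, let d := bfgs_dir (x k) (B k) in
      let s := adaptive_step (x k) d *: d in
      let y := grad f (x k.+1) - grad f (x k) in
      x k.+1 = x k + s /\ B k.+1 = bfgs_update (B k) s y].

End AdaptiveBFGS.

(* Main.v *)
(* Let q_k = L t_k^2 rho_k^2 / (|g_k|^2 <y_k, s_k>) with rho_k = - <g_k, d_k>,
   and z_k = M rho_k / |d_k|_(x_k).  The trace and determinant formulas for the
   BFGS update and |y|^2 <= L <y, s> give Psi(B_(k+1) / L) <= Psi(B_k / L) + ln q_k,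
   so that the sum of the ln q_i is at least - Psi(B_0 / L), because Psi >= 0.
   Self-concordance bounds |d|_(x + t d) along the search direction; it yields
   f(x_k) - f(x_(k+1)) >= t_k rho_k / 2 and rho_k <= (1 + 2 z_k) <y_k, d_k>,
   hence, with D_k = f(x_k) - min f,
     q_k <= kappa (1 + 2 z_k) (D_k - D_(k+1)) / D_k,   q_k <= kappa.
   Up to an error vanishing when z_k <= 1, the relative decrease is thus at least
   q_k / (3 kappa).  The total error is at most a multiple of M^2 D_0, or, by
   telescoping sqrt D_k, of kappa M sqrt D_0: these are the two terms of the
   minimum.  Summing the tangent inequality q >= c (3 / 2 + ln q),
   c = exp (- 1 / 2), concludes. *)
Require Import Defs.
From mathcomp Require Import all_boot all_order all_algebra.
From mathcomp Require Import all_classical all_reals all_analysis.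
From mathcomp Require Import ring lra.

Set Implicit Arguments.
Unset Strict Implicit.
Unset Printing Implicit Defensive.

Import Order.TTheory GRing.Theory Num.Theory.
Import numFieldNormedType.Exports.

Local Open Scope ring_scope.

(** * Linear algebra and the potential Psi *)

Section LinearAlgebra.
Context {R : realType}.

Lemma dotvE n (u v : 'cV[R]_n) : dotv u v = \sum_i u i 0 * v i 0.
Proof. by rewrite /dotv mxE; apply: eq_bigr => i _; rewrite mxE. Qed.

Lemma dotvC n (u v : 'cV[R]_n) : dotv u v = dotv v u.
Proof. by rewrite !dotvE; apply: eq_bigr => i _; rewrite mulrC. Qed.

Lemma dotvDr n (u v w : 'cV[R]_n) : dotv u (v + w) = dotv u v + dotv u w.
Proof. by rewrite /dotv mulmxDr mxE. Qed.

Lemma dotvZr n a (u v : 'cV[R]_n) : dotv u (a *: v) = a * dotv u v.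
Proof. by rewrite /dotv -scalemxAr mxE. Qed.

Lemma dotvNr n (u v : 'cV[R]_n) : dotv u (- v) = - dotv u v.
Proof. by rewrite /dotv mulmxN mxE. Qed.

Lemma dotvBr n (u v w : 'cV[R]_n) : dotv u (v - w) = dotv u v - dotv u w.
Proof. by rewrite dotvDr dotvNr. Qed.

Lemma dotvDl n (u v w : 'cV[R]_n) : dotv (v + w) u = dotv v u + dotv w u.
Proof. by rewrite dotvC dotvDr !(dotvC u). Qed.

Lemma dotvZl n a (u v : 'cV[R]_n) : dotv (a *: v) u = a * dotv v u.
Proof. by rewrite dotvC dotvZr dotvC. Qed.

Lemma dotvNl n (u v : 'cV[R]_n) : dotv (- v) u = - dotv v u.
Proof. by rewrite dotvC dotvNr dotvC. Qed.

Lemma dotvBl n (u v w : 'cV[R]_n) : dotv (v - w) u = dotv v u - dotv w u.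
Proof. by rewrite dotvDl dotvNl. Qed.

Lemma dotv0l n (u : 'cV[R]_n) : dotv 0 u = 0.
Proof. by rewrite /dotv trmx0 mul0mx mxE. Qed.

Lemma dotv0r n (u : 'cV[R]_n) : dotv u 0 = 0.
Proof. by rewrite dotvC dotv0l. Qed.

Definition dotvE_lin := (dotvDl, dotvDr, dotvBl, dotvBr, dotvNl, dotvNr,
                         dotvZl, dotvZr).

Lemma dotv_ge0 n (u : 'cV[R]_n) : 0 <= dotv u u.
Proof. by rewrite dotvE; apply: sumr_ge0 => i _; rewrite -expr2 sqr_ge0. Qed.

Lemma dotv_gt0 n (u : 'cV[R]_n) : u != 0 -> 0 < dotv u u.
Proof.
move=> u0; rewrite lt_def dotv_ge0 andbT; apply: contra u0 => /eqP.
rewrite dotvE => /psumr_eq0P uu0; apply/eqP/matrixP => i j.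
rewrite (ord1 j) mxE; apply/eqP; rewrite -sqrf_eq0 expr2.
by apply/eqP/uu0 => // k _; rewrite -expr2 sqr_ge0.
Qed.

Lemma dotv_CS n (u v : 'cV[R]_n) : dotv u v ^+ 2 <= dotv u u * dotv v v.
Proof.
have [->|v0] := eqVneq v 0; first by rewrite !dotv0r mulr0 expr0n.
have vv := dotv_gt0 v0.
have := dotv_ge0 (dotv v v *: u - dotv u v *: v).
rewrite !dotvE_lin (dotvC v u) => H.
have {}H : 0 <= dotv v v * (dotv u u * dotv v v - dotv u v ^+ 2).
  by apply: le_trans H _; rewrite le_eqVlt; apply/orP; left; apply/eqP; ring.
by move: H; rewrite pmulr_rge0 // subr_ge0.
Qed.

Lemma enormE n (u : 'cV[R]_n) : enorm u ^+ 2 = dotv u u.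
Proof. by rewrite sqr_sqrtr ?dotv_ge0. Qed.

Lemma dotv_mulmx n (u v : 'cV[R]_n) (A : 'M[R]_n) :
  A^T = A -> dotv u (A *m v) = dotv (A *m u) v.
Proof. by move=> AT; rewrite /dotv trmx_mul AT mulmxA. Qed.

(** Weinstein-Aronszajn identity: [e1] and [e2] are a block LU and a block UL factorization of the
    same matrix. *)
Lemma det_1addmul m n (U : 'M[R]_(n, m)) (V : 'M[R]_(m, n)) :
  \det (1%:M + U *m V) = \det (1%:M + V *m U).
Proof.
have e1 : block_mx 1%:M (- V) U 1%:M =
          block_mx 1%:M 0 U 1%:M *m block_mx 1%:M (- V) 0 (1%:M + U *m V).
  rewrite mulmx_block !(mul0mx, mul1mx, mulmx1, mulmx0, addr0, mulmxN).
  by rewrite (addrC 1%:M) addKr.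
have e2 : block_mx 1%:M (- V) U 1%:M =
          block_mx 1%:M (- V) 0 1%:M *m block_mx (1%:M + V *m U) 0 U 1%:M.
  rewrite mulmx_block !(mul0mx, mul1mx, mulmx1, mulmx0, addr0, add0r, mulNmx).
  by rewrite addrK.
have := congr1 (@determinant _ _) e2; rewrite {1}e1 !det_mulmx.
by rewrite !(det_lblock, det_ublock) !det1 !(mul1r, mulr1).
Qed.

Lemma posdef_tr n (A : 'M[R]_n) : posdef A -> A^T = A.
Proof. by case. Qed.

Lemma posdef_Schur n (a : 'M[R]_1) (b : 'cV[R]_n) (C : 'M[R]_n) :
  posdef (block_mx a b^T b C) ->
  0 < a 0 0 /\ posdef (C - (a 0 0)^-1 *: (b *m b^T)).
Proof.
move=> [sA pA].
have CT : C^T = C by move: sA; rewrite tr_block_mx => /eq_block_mx [].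
have quad (u : 'cV[R]_1) (v : 'cV[R]_n) :
    dotv (col_mx u v) (block_mx a b^T b C *m col_mx u v) =
    a 0 0 * u 0 0 ^+ 2 + 2 * u 0 0 * dotv b v + dotv v (C *m v).
  rewrite mul_block_col /dotv tr_col_mx mul_row_col !mulmxDr.
  rewrite [a]mx11_scalar [u]mx11_scalar !tr_scalar_mx !mul_scalar_mx.
  rewrite !mul_mx_scalar -!scalemxAr !mxE eqxx mulr1n.
  have -> : \sum_j v^T 0 j * b j 0 = dotv b v.
    by rewrite dotvC /dotv mxE; apply: eq_bigr => j _.
  have -> : \sum_j b^T 0 j * v j 0 = dotv b v by rewrite /dotv mxE.
  rewrite /=; ring.
have a0 : 0 < a 0 0.
  have nz : col_mx (1%:M : 'cV[R]_1) (0 : 'cV[R]_n) != 0.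
    by rewrite col_mx_eq0 negb_and oner_neq0.
  have := pA _ nz; rewrite quad mulmx0 !dotv0r !mxE eqxx.
  by rewrite /= expr1n mulr1 !mulr0 !addr0.
split=> //; split.
  by rewrite linearB /= linearZ /= trmx_mul trmxK CT.
move=> v v0.
(* For fixed [v] this first coordinate minimizes the quadratic form; the minimum is the form of the
   Schur complement at [v]. *)
have nz : col_mx ((- (a 0 0)^-1 * dotv b v)%:M : 'cV[R]_1) v != 0.
  by rewrite col_mx_eq0 negb_and v0 orbT.
have := pA _ nz; rewrite quad !mxE eqxx mulr1n.
rewrite mulmxBl dotvBr -scalemxAl dotvZr -mulmxA.
have -> : b *m (b^T *m v) = dotv b v *: b.
  by rewrite [b^T *m v]mx11_scalar mul_mx_scalar.
rewrite dotvZr (dotvC v b) => h; apply: lt_le_trans h _.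
rewrite le_eqVlt; apply/orP; left; apply/eqP; field.
exact: lt0r_neq0.
Qed.

Lemma det_Schur n (a : 'M[R]_1) (b : 'cV[R]_n) (C : 'M[R]_n) :
  a 0 0 != 0 ->
  \det (block_mx a b^T b C) =
  a 0 0 * \det (C - (a 0 0)^-1 *: (b *m b^T)).
Proof.
move=> a0.
have -> : block_mx a b^T b C =
    block_mx 1%:M 0 ((a 0 0)^-1 *: b) 1%:M *m
    block_mx a b^T 0 (C - (a 0 0)^-1 *: (b *m b^T)).
  rewrite mulmx_block !(mul0mx, mul1mx, mulmx0, addr0).
  rewrite [a in (_ *: b) *m a]mx11_scalar mul_mx_scalar scalerA mulfV //.
  by rewrite scale1r -scalemxAl addrC subrK.
rewrite det_mulmx det_lblock det_ublock !det1 !mul1r.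
by rewrite [in \det a](mx11_scalar a) det_scalar1.
Qed.

(** Eliminating one coordinate at a time stands in for a diagonalization: the determinant is the
    pivot [a] times that of the Schur complement, whose trace is at most that of [C], and the pivot
    contributes [ln a <= a - 1]. *)
Lemma posdef_ln_det n (A : 'M[R]_n) :
  posdef A -> 0 < \det A /\ ln (\det A) <= \tr A - n%:R.
Proof.
elim: n A => [|n IH] A.
  move=> _; rewrite det_mx00 ln1 subr0 /mxtrace big_ord0; split=> //.
rewrite -[n.+1]/(1 + n)%N in A *; move=> pA.
move: (pA); rewrite -(submxK A).
have -> : ursubmx A = (dlsubmx A)^T.
  by rewrite -[in LHS](posdef_tr pA) -trmx_dlsub.
move: (ulsubmx A) (dlsubmx A) (drsubmx A) => a b C {pA}A.
have [a0 /IH [dS lS]] := posdef_Schur A.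
rewrite det_Schur ?gt_eqF //; split; first exact: mulr_gt0.
rewrite lnM ?posrE // mxtrace_block.
have la : ln (a 0 0) <= a 0 0 - 1.
  by have := expR_ge1Dx (ln (a 0 0)); rewrite lnK ?posrE // lerBrDl.
have trS : \tr (C - (a 0 0)^-1 *: (b *m b^T)) <= \tr C.
  rewrite linearB /= linearZ /= mxtrace_mulC.
  have -> : \tr (b^T *m b) = dotv b b by rewrite /mxtrace big_ord1.
  by rewrite gerBl mulr_ge0 ?dotv_ge0 // invr_ge0 ltW.
have -> : \tr a = a 0 0 by rewrite /mxtrace big_ord1.
rewrite natrD; move: lS la trS; lra.
Qed.

Lemma Psi_ge0 n (A : 'M[R]_n) : posdef A -> 0 <= Psi A.
Proof. by move=> /posdef_ln_det [_]; rewrite /Psi; lra. Qed.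

Lemma posdef_unit n (A : 'M[R]_n) : posdef A -> A \in unitmx.
Proof. by move=> /posdef_ln_det [d _]; rewrite unitmxE unitfE gt_eqF. Qed.

Lemma posdefZ n a (A : 'M[R]_n) : 0 < a -> posdef A -> posdef (a *: A).
Proof.
move=> a0 [sA pA]; split; first by rewrite linearZ /= sA.
by move=> v v0; rewrite -scalemxAl dotvZr mulr_gt0 ?pA.
Qed.

(** As a quadratic form at [v], the first two terms of the update give the squared [B]-norm of [w],
    the component of [v] that is [B]-orthogonal to [s]. It vanishes only on multiples of [s], and on
    the nonzero ones the [y] term is positive. *)
Lemma posdef_update n (B : 'M[R]_n) (s y : 'cV[R]_n) :
  posdef B -> 0 < dotv y s -> posdef (bfgs_update B s y).
Proof.
move=> [sB pB] ys.
have s0 : s != 0 by apply: contraTneq ys => ->; rewrite dotv0r ltxx.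
have sBs := pB _ s0; split.
  rewrite /bfgs_update linearD linearB !linearZ /= !trmx_mul !trmxK sB.
  by rewrite !mulmxA.
move=> v v0; rewrite /bfgs_update mulmxDl mulmxBl dotvDr dotvBr.
rewrite -!scalemxAl !dotvZr -!mulmxA.
have -> : s^T *m (B *m v) = (dotv s (B *m v))%:M by rewrite -mx11_scalar.
have -> : y^T *m v = (dotv y v)%:M by rewrite -mx11_scalar.
rewrite !mul_mx_scalar -!scalemxAr !dotvZr (dotvC v y).
have -> : dotv v (B *m s) = dotv s (B *m v).
  by rewrite dotv_mulmx // dotvC.
pose w := v - (dotv s (B *m v) / dotv s (B *m s)) *: s.
have wBw : dotv w (B *m w) = dotv v (B *m v) -
     (dotv s (B *m s))^-1 * (dotv s (B *m v) * dotv s (B *m v)).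
  rewrite /w mulmxBr -scalemxAr !dotvE_lin.
  have -> : dotv v (B *m s) = dotv s (B *m v).
    by rewrite dotv_mulmx // dotvC.
  by field; rewrite gt_eqF.
rewrite -wBw.
have [w0|w0] := eqVneq w 0; last first.
  apply: ltr_wpDr; last exact: pB.
  by rewrite mulr_ge0 -?expr2 ?sqr_ge0 // invr_ge0 ltW.
rewrite w0 dotv0l add0r mulr_gt0 ?invr_gt0 // -expr2 exprn_even_gt0 //=.
have vE : v = (dotv s (B *m v) / dotv s (B *m s)) *: s.
  by apply/eqP; rewrite -subr_eq0; apply/eqP.
rewrite vE dotvZr mulf_neq0 ?(gt_eqF ys) //.
by apply: contra v0 => /eqP e; rewrite vE e scale0r.
Qed.

Lemma det_update n (B : 'M[R]_n) (s y : 'cV[R]_n) :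
  posdef B -> 0 < dotv y s ->
  \det (bfgs_update B s y) = \det B * (dotv y s / dotv s (B *m s)).
Proof.
move=> pB ys.
have s0 : s != 0 by apply: contraTneq ys => ->; rewrite dotv0r ltxx.
have sBs := pB.2 _ s0.
(* The update is a perturbation of [B] of rank at most two, so [det_1addmul] reduces its determinant
   to a 2 by 2 one. *)
pose U := row_mx s (invmx B *m y).
pose V := col_mx (- (dotv s (B *m s))^-1 *: (s^T *m B))
                 ((dotv y s)^-1 *: y^T).
have -> : bfgs_update B s y = B *m (1%:M + U *m V).
  rewrite /U /V mul_row_col mulmxDr mulmx1 mulmxDr /bfgs_update addrA.
  rewrite -!scalemxAr !mulmxA mulmxV ?posdef_unit // mul1mx.
  by rewrite scaleNr.
rewrite det_mulmx det_1addmul; congr (_ * _).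
have -> : 1%:M + V *m U = block_mx 0 (- (dotv y s / dotv s (B *m s)))%:M
     1%:M (1 + (dotv y s)^-1 * dotv y (invmx B *m y))%:M.
  rewrite /V /U mul_col_row -!scalemxAl -mulmxA scalar_mx_block add_block_mx.
  have dE (u v : 'cV[R]_n) : u^T *m v = (dotv u v)%:M.
    exact: mx11_scalar.
  rewrite -mulmxA mulKVmx ?posdef_unit // !dE !scale_scalar_mx -!raddfD /=.
  rewrite !add0r mulNr mulVf ?gt_eqF // subrr mulVf ?gt_eqF //.
  by rewrite mulNr (dotvC s y) (mulrC _ (dotv y s)) raddf0.
move: (1 + _)%:M => d; set b : 'M[R]_1 := (- _)%:M.
(* The upper left entry is zero; adding the second row to the first creates the pivot 1, and
   elimination then leaves [- b]. *)
have : block_mx 1%:M 1%:M 0 1%:M *m block_mx 0 b 1%:M d =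
    block_mx 1%:M 0 1%:M 1%:M *m block_mx 1%:M (b + d) 0 (- b).
  rewrite !mulmx_block !(mul0mx, mul1mx, mulmx1, mulmx0, addr0, add0r).
  by rewrite addrAC subrr add0r.
move/(congr1 (@determinant _ _)); rewrite !det_mulmx !det_ublock det_lblock.
by rewrite !det1 !mul1r -raddfN /= opprK det_scalar1.
Qed.

Lemma Psi_update n (B : 'M[R]_n) (s y : 'cV[R]_n) :
  posdef B -> 0 < dotv y s ->
  Psi (bfgs_update B s y) =
  Psi B - dotv (B *m s) (B *m s) / dotv s (B *m s) + dotv y y / dotv y s
  - ln (dotv y s / dotv s (B *m s)).
Proof.
move=> pB ys.
have s0 : s != 0 by apply: contraTneq ys => ->; rewrite dotv0r ltxx.
have sBs := pB.2 _ s0.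
have [dB _] := posdef_ln_det pB.
rewrite /Psi det_update // [ln (_ * (_ / _))]lnM ?posrE ?divr_gt0 //.
rewrite /bfgs_update mxtraceD raddfB /= !mxtraceZ.
have trE (u v : 'cV[R]_n) : \tr (u *m v^T) = dotv u v.
  by rewrite mxtrace_mulC /mxtrace big_ord1 dotvC.
have -> : B *m s *m s^T *m B = B *m s *m (B *m s)^T.
  by rewrite trmx_mul pB.1 -!mulmxA.
by rewrite !trE; ring.
Qed.

End LinearAlgebra.

(** * Functions of several variables along a line *)

Lemma Ck_le (R : realType) n k (f : 'cV[R]_n -> R) : Ck k.+1 f -> Ck k f.
Proof.
elim: k f => [|k IH] f [df C]; first by move=> z; exact: differentiable_continuous.
by split=> // i; apply: IH.
Qed.

Section Line.
Context {R : realType}.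

Lemma nonincreasing_of_derive (F G : R -> R) (T : R) :
  0 <= T -> (forall t, 0 <= t <= T -> is_derive t 1 F (G t)) ->
  (forall t, 0 <= t <= T -> G t <= 0) -> F T <= F 0.
Proof.
move=> T0 dF G0.
have inT t : t \in `]0, T[ -> 0 <= t <= T.
  by rewrite in_itv /= => /andP[/ltW-> /ltW->].
have cF : {within `[0, T], continuous F}%classic.
  apply: derivable_within_continuous => t; rewrite in_itv /= => /dF.
  by case.
have [c] := MVT_segment T0 (fun t tT => dF t (inT t tT)) cF.
rewrite in_itv /= => c0T e.
by rewrite -subr_le0 e subr0 mulr_le0_ge0 // G0.
Qed.

Context {n : nat}.
Implicit Types (f : 'cV[R]_n -> R) (x d : 'cV[R]_n).

Lemma is_derive_line f x d (t : R) : differentiable f (x + t *: d) ->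
  is_derive t 1 (fun t => f (x + t *: d))
    (\sum_i partial i f (x + t *: d) * d i 0).
Proof.
move=> df.
have dE : d = \sum_i d i 0 *: delta_mx i 0.
  by rewrite {1}[d]matrix_sum_delta; apply: eq_bigr => i _; rewrite big_ord1.
set y := x + t *: d in df *.
have quot : (fun h : R => h^-1 *: (((fun t => f (x + t *: d)) \o shift t) (h *: 1)
      - f y)) =
    (fun h : R => h^-1 *: ((f \o shift y) (h *: d) - f y)).
  apply/funext => h /=; congr (_ *: (f _ - _)).
  by rewrite [h%:A]mulr1 /y scalerDl addrCA.
split; first by rewrite /derivable quot; exact: diff_derivable.
rewrite /derive quot -/(derive f y d) deriveE // [in LHS]dE linear_sum.
by apply: eq_bigr => i _; rewrite linearZ /= -deriveE // [LHS]mulrC.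
Qed.

Lemma is_derive_lincomb m (a : 'I_m -> R) (h : 'I_m -> R -> R) dh (t : R) :
  (forall i, is_derive t 1 (h i) (dh i)) ->
  is_derive t 1 (fun t => \sum_i h i t * a i) (\sum_i dh i * a i).
Proof.
move=> dhP.
have -> : (fun t => \sum_i h i t * a i) = \sum_i (a i \*: h i).
  apply/funext => u; rewrite fct_sumE; apply: eq_bigr => i _.
  by rewrite mulrC.
have H i : is_derive t 1 (a i \*: h i) (a i *: dh i) by apply: is_deriveZ.
apply: is_derive_eq (is_derive_sum H) _.
by apply: eq_bigr => i _; rewrite mulrC.
Qed.

Lemma is_derive_grad f x d (t : R) : Ck 2 f ->
  is_derive t 1 (fun t => dotv (grad f (x + t *: d)) d)
    (dotv d (hess f (x + t *: d) *m d)).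
Proof.
move=> [_ C1].
have -> : (fun t => dotv (grad f (x + t *: d)) d) =
    fun t => \sum_j partial j f (x + t *: d) * d j 0.
  by apply/funext => u; rewrite dotvE; apply: eq_bigr => j _; rewrite mxE.
apply: is_derive_eq; first apply: is_derive_lincomb => j.
  by apply: is_derive_line; exact: (C1 j).1.
rewrite dotvE.
under [RHS]eq_bigr do rewrite mxE mulr_sumr.
rewrite exchange_big /=; apply: eq_bigr => j _; rewrite mulr_suml.
by apply: eq_bigr => i _; rewrite mxE [RHS]mulrCA mulrA.
Qed.

Lemma is_derive_hess f x d (t : R) : Ck 3 f ->
  is_derive t 1 (fun t => dotv d (hess f (x + t *: d) *m d))
    (third f (x + t *: d) d).
Proof.
move=> [_ C2].
have -> : (fun t => dotv d (hess f (x + t *: d) *m d)) =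
    fun t => \sum_k (\sum_j partial j (partial k f) (x + t *: d) * d j 0) * d k 0.
  apply/funext => u; rewrite dotvE.
  under [LHS]eq_bigr do rewrite mxE mulr_sumr.
  rewrite exchange_big /=; apply: eq_bigr => j _; rewrite mulr_suml.
  by apply: eq_bigr => i _; rewrite mxE mulrCA mulrA.
apply: is_derive_eq.
  apply: is_derive_lincomb => k; apply: is_derive_lincomb => j.
  by apply: is_derive_line; exact: (((C2 k).2 j).1).
rewrite /third.
under [RHS]eq_bigr do rewrite exchange_big /=.
rewrite [RHS]exchange_big /=; apply: eq_bigr => k _.
rewrite [RHS]exchange_big /= mulr_suml; apply: eq_bigr => j _.
by rewrite !mulr_suml.
Qed.

End Line.

(** * One-dimensional differential inequalities *)

Section Real.
Context {R : realType}.

Lemma le_growth_of_derive (F G dF dG : R -> R) (T : R) :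
  0 <= T -> (forall t, 0 <= t <= T -> is_derive t 1 F (dF t)) ->
  (forall t, 0 <= t <= T -> is_derive t 1 G (dG t)) ->
  (forall t, 0 <= t <= T -> dF t <= dG t) -> F T - F 0 <= G T - G 0.
Proof.
move=> T0 hF hG le.
have := @nonincreasing_of_derive R (F - G) (fun t => dF t - dG t) T T0.
rewrite /= !fctE => H; suff : F T - G T <= F 0 - G 0 by lra.
apply: H => t tT; first by apply: is_deriveB; [exact: hF|exact: hG].
by rewrite subr_le0 le.
Qed.

Lemma is_derive_quadratic (b c t : R) :
  is_derive t 1 (fun t => b * t + c * t ^+ 2) (b + 2 * c * t).
Proof.
have -> : (fun t => b * t + c * t ^+ 2) = (b \*: id) + (c \*: (id ^+ 2)).
  by apply/funext => u /=; rewrite !fctE.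
apply: is_derive_eq.
by rewrite /= expr1 /GRing.scale /=; ring.
Qed.

(** On [[0, 1]] the difference [K] of [F] and the quadratic is largest at 0, so its right difference
    quotients there are nonpositive. This turns the inequality defining strong convexity into bounds
    on derivatives. *)
Lemma derive_le_slope (F : R -> R) (a b c : R) :
  is_derive (0 : R) (1 : R) F a ->
  (forall t, 0 <= t <= 1 -> F t - F 0 <= b * t + c * t ^+ 2) -> a <= b.
Proof.
move=> dF le; rewrite -subr_le0.
pose K : R -> R := F - (fun t => b * t + c * t ^+ 2).
have dK : is_derive (0 : R) (1 : R) K (a - b).
  have := is_deriveB dF (is_derive_quadratic b c 0).
  by rewrite mulr0 addr0.
have Kle t : 0 <= t <= 1 -> K t <= K 0.
  by move=> /le; rewrite /K !fctE expr0n /= !mulr0 addr0; lra.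
have [dvK <-] := dK.
have : ((fun h => h^-1 *: (K (h *: 1 + 0) - K 0)) h @[h --> 0^'+] --> 'D_1 K 0)%classic.
  exact: cvg_dnbhs_at_right dvK.
move/cvgr_to_le; apply; near=> h.
have h0 : 0 < h by near: h; exact: nbhs_right_gt.
have h1 : h <= 1 by near: h; exact: nbhs_right_le.
rewrite addr0 [h *: 1]mulr1 /GRing.scale /= pmulr_rle0 ?invr_gt0 //.
by rewrite subr_le0 Kle // ltW.
Unshelve. all: by end_near. Qed.

(** The primitive, vanishing at 0, of the squared bound on the local norm that self-concordance
    provides; it serves with [a] the inverse of the local norm at [x] and [c] equal to [M] or
    [- M]. *)
Lemma is_derive_homographic (a c t : R) : c != 0 -> a + c * t != 0 ->
  is_derive t 1 (fun t => c^-1 * (a^-1 - (a + c * t)^-1)) ((a + c * t) ^- 2).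
Proof.
move=> c0 act0.
have d1 : is_derive t 1 (fun t => a + c * t) c.
  have -> : (fun t => a + c * t) = cst a + c \*: id by apply/funext.
  by apply: is_derive_eq; rewrite add0r [c *: 1]mulr1.
have d2 := is_deriveV (f := fun t => a + c * t) act0 d1.
have -> : (fun t => c^-1 * (a^-1 - (a + c * t)^-1)) =
          c^-1 \*: (cst a^-1 - (fun t => (a + c * t)^-1)) by apply/funext.
apply: is_derive_eq.
by rewrite sub0r /GRing.scale /= mulNr opprK mulrCA mulVf // mulr1.
Qed.

Lemma is_derive_invsqrt (u : R -> R) (t du : R) : 0 < u t ->
  is_derive t 1 u du ->
  is_derive t 1 (fun t => (Num.sqrt (u t))^-1)
    (- du / (2 * Num.sqrt (u t) ^+ 3)).
Proof.
move=> u0 hu.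
have s0 : Num.sqrt (u t) != 0 by rewrite gt_eqF // sqrtr_gt0.
have ds := is_derive1_comp (is_derive1_sqrt u0) hu.
apply: is_derive_eq (is_deriveV (f := Num.sqrt \o u) s0 ds) _.
by rewrite /GRing.scale /=; field.
Qed.

(* [d/dt u^(-1/2) = - u' / (2 u^(3/2))] lies in [[-M, M]]. *)
Lemma self_concordant_ode (u du : R -> R) (M T : R) :
  0 <= T ->
  (forall t, 0 <= t <= T -> 0 < u t) ->
  (forall t, 0 <= t <= T -> is_derive t 1 u (du t)) ->
  (forall t, 0 <= t <= T -> `|du t| <= 2 * M * Num.sqrt (u t) ^+ 3) ->
  (Num.sqrt (u 0))^-1 - M * T <= (Num.sqrt (u T))^-1
    <= (Num.sqrt (u 0))^-1 + M * T.
Proof.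
move=> T0 u0 hu le.
have dq b (t : R) : is_derive t 1 (fun t => b * t + 0 * t ^+ 2) b.
  by apply: is_derive_eq (is_derive_quadratic b 0 t) _; rewrite mulr0 mul0r addr0.
have dv t : 0 <= t <= T -> is_derive t 1 (fun t => (Num.sqrt (u t))^-1)
    (- du t / (2 * Num.sqrt (u t) ^+ 3)).
  by move=> tT; apply: is_derive_invsqrt; [exact: u0|exact: hu].
have bd t : 0 <= t <= T -> `|- du t / (2 * Num.sqrt (u t) ^+ 3)| <= M.
  move=> tT.
  have s0 : 0 < 2 * Num.sqrt (u t) ^+ 3.
    by rewrite mulr_gt0 // exprn_gt0 // sqrtr_gt0 u0.
  rewrite normrM normrN normfV (gtr0_norm s0) ler_pdivrMr // mulrA (mulrC M).
  exact: le.
have bd1 t : 0 <= t <= T -> - du t / (2 * Num.sqrt (u t) ^+ 3) <= M.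
  by move=> /bd; rewrite ler_norml => /andP[].
have bd2 t : 0 <= t <= T -> - M <= - du t / (2 * Num.sqrt (u t) ^+ 3).
  by move=> /bd; rewrite ler_norml => /andP[].
have := le_growth_of_derive T0 dv (fun t _ => dq M t) bd1.
have := le_growth_of_derive T0 (fun t _ => dq (- M) t) dv bd2.
rewrite /= !(mul0r, mulr0, addr0) => h1 h2.
by apply/andP; split; lra.
Qed.

End Real.

(** * Strong convexity and Lipschitz gradients *)

Section Inequalities.
Context {R : realType} {n : nat}.
Implicit Types (f : 'cV[R]_n -> R) (x w d s : 'cV[R]_n) (mu L M : R).

Lemma is_derive_along f x w (t : R) : Ck 1 f ->
  is_derive t 1 (fun t => f (x + t *: w)) (dotv (grad f (x + t *: w)) w).
Proof.
move=> [df _]; have := is_derive_line (df (x + t *: w)).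
have -> // : dotv (grad f (x + t *: w)) w = \sum_i partial i f (x + t *: w) * w i 0.
by rewrite dotvE; apply: eq_bigr => i _; rewrite mxE.
Qed.

(** Strong convexity between [x] and [x + w] bounds the increment of [f] along the segment by a
    quadratic in [t]; the derivative at 0 is at most the slope of that quadratic. *)
Lemma strongly_convex_lower mu f x w : Ck 1 f -> strongly_convex mu f ->
  f x + dotv (grad f x) w + mu / 2 * dotv w w <= f (x + w).
Proof.
move=> C1 sc.
have d0 := is_derive_along x w 0 C1; rewrite scale0r addr0 in d0.
have := derive_le_slope (b := f (x + w) - f x - mu / 2 * dotv w w)
  (c := mu / 2 * dotv w w) d0.
suff H t : 0 <= t <= 1 -> f (x + t *: w) - f (x + 0 *: w) <=
    (f (x + w) - f x - mu / 2 * dotv w w) * t + mu / 2 * dotv w w * t ^+ 2.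
  by move=> /(_ H); lra.
move=> /(sc (x + w) x t).
have -> : t *: (x + w) + (1 - t) *: x = x + t *: w.
  by rewrite scalerDr scalerBl scale1r (addrC (t *: x)) addrACA subrr addr0 addrC.
rewrite enormE [x + w - x]addrAC subrr add0r scale0r addr0 => h.
rewrite lerBlDr; apply: le_trans h _.
by rewrite le_eqVlt; apply/orP; left; apply/eqP; field.
Qed.

Lemma grad_strongly_monotone mu f x s : Ck 1 f -> strongly_convex mu f ->
  mu * dotv s s <= dotv (grad f (x + s) - grad f x) s.
Proof.
move=> C1 sc; have h1 := strongly_convex_lower x s C1 sc.
have := strongly_convex_lower (x + s) (- s) C1 sc.
by rewrite addrK !dotvE_lin opprK; lra.
Qed.

(** Strong monotonicity of the gradient, divided by [t] and passed to the derivative at 0. The signs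
    are reversed to fit the upper bound of [derive_le_slope]. For [0 < mu] it keeps the local norms
    of nonzero directions positive. *)
Lemma hess_lower mu f x d : Ck 2 f -> strongly_convex mu f ->
  mu * dotv d d <= dotv d (hess f x *m d).
Proof.
move=> C2 sc.
have C1 := Ck_le C2.
have := is_deriveN (is_derive_grad x d 0 C2).
rewrite scale0r addr0 => d0; rewrite -lerN2.
apply: (derive_le_slope (c := 0) d0) => t /andP[t0 t1].
rewrite mul0r addr0 !fctE scale0r addr0.
have [->|tn0] := eqVneq t 0; first by rewrite scale0r !addr0 mulr0 subrr.
have tp : 0 < t by rewrite lt_def tn0.
have := grad_strongly_monotone x (t *: d) C1 sc.
rewrite !dotvE_lin -mulrBr !(mulrCA mu) !(ler_pM2l tp); lra.
Qed.

(** Polyak-Lojasiewicz inequality: the quadratic lower bound at [x] is minimized over the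
    displacement [w] by completing the square of [g + mu w]. *)
Lemma gradient_dominated mu f x xs : 0 < mu -> Ck 1 f -> strongly_convex mu f ->
  2 * mu * (f x - f xs) <= dotv (grad f x) (grad f x).
Proof.
move=> mu0 C1 sc; have := strongly_convex_lower x (xs - x) C1 sc.
rewrite addrCA subrr addr0; move: (grad f x) (xs - x) => g w.
have := dotv_ge0 (g + mu *: w); rewrite !dotvE_lin (dotvC w g).
nra.
Qed.

Lemma lipschitz_grad_upper L f x w : 0 < L -> Ck 1 f -> lipschitz_grad L f ->
  f (x + w) <= f x + dotv (grad f x) w + L / 2 * dotv w w.
Proof.
move=> L0 C1 lip.
have := @le_growth_of_derive R (fun t => f (x + t *: w))
  (fun t => dotv (grad f x) w * t + L / 2 * dotv w w * t ^+ 2)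
  _ _ 1 ler01 (fun t _ => is_derive_along x w t C1)
  (fun t _ => is_derive_quadratic _ _ t).
rewrite /= scale1r scale0r addr0 expr1n expr0n /= !mulr1 !mulr0 addr0 subr0.
move=> H; suff: f (x + w) - f x <= dotv (grad f x) w + L / 2 * dotv w w by lra.
apply: H => t /andP[t0 t1].
have le1 := lip (x + t *: w) x; rewrite addrAC subrr add0r in le1.
have : dotv (grad f (x + t *: w) - grad f x) w <=
       enorm (grad f (x + t *: w) - grad f x) * enorm w.
  apply: le_trans (ler_norm _) _; rewrite -ler_sqr ?nnegrE ?mulr_ge0 ?sqrtr_ge0 //.
  by rewrite real_normK ?num_real // exprMn !enormE dotv_CS.
have et : enorm (t *: w) = t * enorm w.
  rewrite /enorm !dotvE_lin mulrA -expr2 sqrtrM ?sqr_ge0 //.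
  by rewrite sqrtr_sqr ger0_norm.
rewrite et in le1.
have := ler_wpM2r (sqrtr_ge0 (dotv w w)) le1.
rewrite -/(enorm w) -!mulrA -expr2 enormE dotvBl.
lra.
Qed.

Lemma cocoercive mu L f x s : 0 < mu -> 0 < L -> Ck 1 f ->
  strongly_convex mu f -> lipschitz_grad L f ->
  dotv (grad f (x + s) - grad f x) (grad f (x + s) - grad f x) <=
  L * dotv (grad f (x + s) - grad f x) s.
Proof.
move=> mu0 L0 C1 sc lip.
(* The tangent at [a] lies below [f], which lies below the quadratic model at [b]. The two are
   compared at [b - h / L], where their gap is smallest; exchanging [a] and [b] and adding gives the
   claim. *)
have half a b : f a + dotv (grad f a) (b - a) +
    (2 * L)^-1 * dotv (grad f b - grad f a) (grad f b - grad f a) <= f b.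
  set h := grad f b - grad f a.
  have := lipschitz_grad_upper b (- L^-1 *: h) L0 C1 lip.
  have := strongly_convex_lower a (b - a - L^-1 *: h) C1 sc.
  have -> : a + (b - a - L^-1 *: h) = b + - L^-1 *: h.
    by rewrite scaleNr addrA [a + _]addrC subrK.
  have : 0 <= mu / 2 * dotv (b - a - L^-1 *: h) (b - a - L^-1 *: h).
    by rewrite mulr_ge0 ?dotv_ge0 // divr_ge0 // ltW.
  have -> : L / 2 * dotv (- L^-1 *: h) (- L^-1 *: h) = (2 * L)^-1 * dotv h h.
    by rewrite !dotvE_lin; field; rewrite gt_eqF.
  have : dotv (grad f b) h = dotv (grad f a) h + dotv h h.
    by rewrite /h !dotvE_lin; ring.
  have -> : (2 * L)^-1 = L^-1 / 2 by rewrite invfM mulrC.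
  rewrite [dotv (grad f a) (b - a - _)]dotvBr [dotv _ (L^-1 *: h)]dotvZr.
  rewrite [dotv _ (- L^-1 *: h)]dotvZr => ->.
  move: (mu / 2 * _) (dotv (grad f a) (b - a)) (dotv (grad f a) h) (dotv h h) (f a)
    (f b) (f (b + _)) => A B C D E F G.
  nra.
have := half x (x + s); have := half (x + s) x.
have -> : x + s - x = s by rewrite addrAC subrr add0r.
have -> : x - (x + s) = - s by rewrite opprD addrA subrr sub0r.
have -> : grad f x - grad f (x + s) = - (grad f (x + s) - grad f x).
  by rewrite opprB.
rewrite !dotvNr dotvNl opprK.
move: (dotv (_ - _) (_ - _)) => Y h1 h2.
have -> : Y = L * (2 * ((2 * L)^-1 * Y)) by field; rewrite gt_eqF.
rewrite (ler_pM2l L0) dotvBl; lra.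
Qed.

End Inequalities.

(** * Self-concordance and the adaptive step *)

Section SelfConcordance.
Context {R : realType} {n : nat}.
Variables (f : 'cV[R]_n -> R) (mu M : R).
Hypotheses (mu0 : 0 < mu) (M0 : 0 < M) (C3 : Ck 3 f).
Hypotheses (sc : strongly_convex mu f) (hself : self_concordant M f).

Let C2 : Ck 2 f := Ck_le C3.
Let C1 : Ck 1 f := Ck_le C2.

Variables (x d : 'cV[R]_n).
Hypothesis d0 : d != 0.

Lemma hess_gt0 z : 0 < dotv d (hess f z *m d).
Proof.
by apply: lt_le_trans (hess_lower z d C2 sc); rewrite mulr_gt0 ?dotv_gt0.
Qed.

Lemma hnorm_gt0 z : 0 < hnorm f z d.
Proof. by rewrite sqrtr_gt0 hess_gt0. Qed.

Lemma hnormV_bound T : 0 <= T ->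
  (hnorm f x d)^-1 - M * T <= (hnorm f (x + T *: d) d)^-1
    <= (hnorm f x d)^-1 + M * T.
Proof.
move=> T0.
have := @self_concordant_ode R (fun t => dotv d (hess f (x + t *: d) *m d))
  (fun t => third f (x + t *: d) d) M T T0 (fun t _ => hess_gt0 _)
  (fun t _ => is_derive_hess x d t C3) (fun t _ => hself.2 _ _).
by rewrite scale0r addr0.
Qed.

(** While [M h t < 1], the local norm at [x + t d] is at most the inverse of [1 / h - M t]; the
    square of this bound is integrated over [[0, T]]. *)
Lemma grad_growth_upper T : 0 <= T -> M * hnorm f x d * T < 1 ->
  dotv (grad f (x + T *: d) - grad f x) d <=
  T * hnorm f x d ^+ 2 / (1 - M * hnorm f x d * T).
Proof.
move=> T0 MT1; have h0 := hnorm_gt0 x; set h := hnorm f x d in MT1 h0 *.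
have pos t : 0 <= t <= T -> 0 < h^-1 + - M * t.
  move=> /andP[t0 tT]; rewrite mulNr subr_gt0 -[ltRHS]mul1r ltr_pdivlMr //.
  apply: le_lt_trans MT1; rewrite mulrAC ler_pM2l ?mulr_gt0 //.
have M0' : - M != 0 by rewrite oppr_eq0 gt_eqF.
have := le_growth_of_derive T0 (fun t _ => is_derive_grad x d t C2)
  (fun t tT => is_derive_homographic M0' (lt0r_neq0 (pos t tT))).
rewrite /= scale0r addr0 mulr0 addr0 subrr mulr0 subr0 dotvBl.
suff -> : (- M)^-1 * (h^-1^-1 - (h^-1 + - M * T)^-1) =
   T * h ^+ 2 / (1 - M * h * T).
  apply=> t tT; have /andP[t0 _] := tT.
  have /andP[le _] := hnormV_bound t0; rewrite -/h -mulNr in le.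
  rewrite -[leLHS]sqr_sqrtr ?(ltW (hess_gt0 _)) // -/(hnorm f _ d).
  have pt := pos t tT; have hg := hnorm_gt0 (x + t *: d).
  rewrite -exprVn; move: (hnorm f _ d) (h^-1 + _) hg pt le => a b a0 b0 le.
  rewrite ler_pXn2r ?nnegrE ?invr_ge0 ?(ltW a0) ?(ltW b0) //.
  by rewrite -[leLHS]invrK lef_pV2 ?posrE ?invr_gt0.
by field; rewrite !gt_eqF //= subr_gt0.
Qed.

(** The mirror argument with [1 / h + M t], which stays positive for every [t >= 0]. *)
Lemma grad_growth_lower T : 0 <= T ->
  T * hnorm f x d ^+ 2 / (1 + M * hnorm f x d * T) <=
  dotv (grad f (x + T *: d) - grad f x) d.
Proof.
move=> T0; have h0 := hnorm_gt0 x; set h := hnorm f x d in h0 *.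
have pos t : 0 <= t <= T -> 0 < h^-1 + M * t.
  by move=> /andP[t0 tT]; rewrite ltr_pwDl ?invr_gt0 // mulr_ge0 // ltW.
have M0' : M != 0 by rewrite gt_eqF.
have := le_growth_of_derive T0
  (fun t tT => is_derive_homographic M0' (lt0r_neq0 (pos t tT)))
  (fun t _ => is_derive_grad x d t C2).
rewrite /= scale0r addr0 mulr0 addr0 subrr mulr0 subr0 dotvBl.
suff -> : M^-1 * (h^-1^-1 - (h^-1 + M * T)^-1) =
   T * h ^+ 2 / (1 + M * h * T).
  apply=> t tT; have /andP[t0 _] := tT.
  have /andP[_ le] := hnormV_bound t0; rewrite -/h in le.
  rewrite -[leRHS]sqr_sqrtr ?(ltW (hess_gt0 _)) // -/(hnorm f _ d).
  have pt := pos t tT; have hg := hnorm_gt0 (x + t *: d).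
  rewrite -exprVn; move: (hnorm f _ d) (h^-1 + _) hg pt le => a b a0 b0 le.
  rewrite ler_pXn2r ?nnegrE ?invr_ge0 ?(ltW a0) ?(ltW b0) //.
  by rewrite -[leRHS]invrK lef_pV2 ?posrE ?invr_gt0.
by field; rewrite !gt_eqF //= ?ltr_pwDl // !mulr_ge0 // ltW.
Qed.

Let rho := - dotv (grad f x) d.
Hypothesis rho0 : 0 < rho.
Let h := hnorm f x d.
Let t := adaptive_step M f x d.

Lemma adaptive_stepE : t = rho / (h * (h + M * rho)).
Proof. by rewrite /t /adaptive_step -/h /rho -mulNr mulrN. Qed.

Lemma adaptive_step_gt0 : 0 < t.
Proof.
have h0 := hnorm_gt0 x.
by rewrite adaptive_stepE divr_gt0 // mulr_gt0 // addr_gt0 // mulr_gt0.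
Qed.

(* On [[0, t]] the bound of [grad_growth_upper] lies below its chord, so that
   [f] decreases at least as much as a quadratic minimized at [t]. *)
Lemma adaptive_step_decrease : f (x + t *: d) <= f x - t * rho / 2.
Proof.
have h0 : 0 < h := hnorm_gt0 x; have t0 := adaptive_step_gt0.
have tE := adaptive_stepE.
have hr0 : 0 < h + M * rho by rewrite addr_gt0 // mulr_gt0.
have h1 : 1 - M * h * t = h / (h + M * rho).
  by rewrite tE; field; rewrite !gt_eqF.
have := le_growth_of_derive (ltW t0) (fun s _ => is_derive_along x d s C1)
  (fun s _ => is_derive_quadratic (- rho) (rho / (2 * t)) s).
rewrite /= scale0r addr0 expr0n /= !mulr0 addr0 subr0.
have -> : - rho * t + rho / (2 * t) * t ^+ 2 = - (t * rho / 2).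
  by field; rewrite gt_eqF.
move=> H; rewrite [leRHS]addrC -lerBlDr; apply: H.
move=> s /andP[s0 st].
have st1 : M * h * s <= M * h * t by rewrite ler_pM2l // mulr_gt0.
have pos1 : 0 < 1 - M * h * t by rewrite h1 divr_gt0.
have := grad_growth_upper s0; rewrite dotvBl -/h => /(_ _)/[dup] H.
have {}H : M * h * s < 1 by lra.
move/(_ H).
have : s * h ^+ 2 / (1 - M * h * s) <= s * h ^+ 2 / (1 - M * h * t).
  have pos2 : 0 < 1 - M * h * s by rewrite subr_gt0.
  apply: ler_wpM2l; first by rewrite mulr_ge0 ?sqr_ge0.
  by rewrite lef_pV2 ?posrE // lerD2l lerN2.
(* The adaptive step is the value of [t] at which the growth bound equals [rho], so the chord has
   slope [rho / t]. *)
have -> : s * h ^+ 2 / (1 - M * h * t) = 2 * (rho / (2 * t)) * s.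
  by rewrite h1 tE; field; rewrite !gt_eqF.
rewrite /rho; lra.
Qed.

(** At the adaptive step the lower growth bound equals exactly [rho / (1 + 2 z)] with
    [z = M rho / h]. *)
Lemma adaptive_step_curvature :
  rho <= dotv (grad f (x + t *: d) - grad f x) d * (1 + 2 * (M * (rho / h))).
Proof.
have h0 : 0 < h := hnorm_gt0 x; have t0 := adaptive_step_gt0.
have tE := adaptive_stepE.
have hr0 : 0 < h + M * rho by rewrite addr_gt0 // mulr_gt0.
have hr1 : 0 < h + 2 * (M * rho) by rewrite addr_gt0 // !mulr_gt0.
have z0 : 0 < 1 + 2 * (M * (rho / h)) by rewrite addr_gt0 // !mulr_gt0 ?invr_gt0.
rewrite -ler_pdivrMr //; apply: le_trans (grad_growth_lower (ltW t0)).
rewrite -/h le_eqVlt; apply/orP; left; apply/eqP; rewrite tE.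
move: (rho) rho0 hr0 hr1 {z0 tE t0} => r r0 hr0 hr1; field.
have -> : h + M * r + M * r = h + 2 * (M * r) by ring.
by rewrite !gt_eqF.
Qed.

End SelfConcordance.

(** * Scalar estimates *)

Section Scalar.
Context {R : realType}.
Implicit Types (q x : R).

(** The 16th power of [exp (- 1 / 32) >= 31 / 32], computed by four squarings with rounding down. *)
Lemma expRN_half_ge : 3 / 5 <= expR (- (1 / 2) : R).
Proof.
have e : - (1 / 2) = 16%:R * (- (1 / 32)) :> R by field.
rewrite e expRM_natl; set a : R := expR _.
have a1 : 31 / 32 <= a by have := expR_ge1Dx (- (1 / 32) : R); rewrite /a; lra.
have a2 : 9384 / 10000 <= a ^+ 2 by rewrite expr2; nra.
have a4 : 8805 / 10000 <= (a ^+ 2) ^+ 2 by rewrite (expr2 (a ^+ 2)); nra.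
have a8 : 775 / 1000 <= ((a ^+ 2) ^+ 2) ^+ 2.
  by move: ((a ^+ 2) ^+ 2) a4 => b b4; rewrite expr2; nra.
rewrite (_ : a ^+ 16 = (((a ^+ 2) ^+ 2) ^+ 2) ^+ 2); last by rewrite -!exprM.
by move: (((a ^+ 2) ^+ 2) ^+ 2) a8 => b b8; rewrite expr2; nra.
Qed.

(** The line in [ln q] touches at [q = exp (- 1 / 2)]. Each iteration thus contributes [3 / 2]: in
    the final count one unit gives the rate, and the remaining half pays for [Psi] and for the
    errors. *)
Lemma tangent_ln q : 0 < q -> expR (- (1 / 2)) * (3 / 2 + ln q) <= q.
Proof.
move=> q0; have := expR_ge1Dx (1 / 2 + ln q).
rewrite expRD lnK ?posrE // -(ler_pM2l (expR_gt0 (- (1 / 2)))).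
by rewrite mulrA -expRD addNr expR0 mul1r; lra.
Qed.

(** Since [exp (6 x / 5) >= 1 + 6 x / 5], it suffices that [(1 - x) (1 + 6 x / 5) >= 1], which for
    [x >= 0] holds when [x <= 1 / 6]. *)
Lemma ln_onem_ge x : 0 <= x <= 1 / 6 -> - (6 / 5) * x <= ln (1 - x).
Proof.
move=> /andP[x0 x6]; have x1 : 0 < 1 - x by lra.
rewrite -ler_expR lnK ?posrE // mulNr expRN.
rewrite -[leLHS]mul1r ler_pdivrMr ?expR_gt0 //.
have := expR_ge1Dx (6 / 5 * x); nra.
Qed.

(* With [P = t rho], [z = M rho / |d|_x] and
   [q = L t^2 rho^2 / (|g|^2 <y, s>)], an iteration with [z <= 1] is efficient;
   the others are charged to the decrease of [D], resp. of [sqrt D]. *)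
Lemma efficient_iteration (kappa D D' P z q : R) :
  0 < D -> 0 < z -> 1 <= kappa -> P <= 2 * (D - D') ->
  2 * q * D <= kappa * P * (1 + 2 * z) ->
  q <= kappa * (1 + 2 * z) * ((D - D') / D).
Proof.
move=> D0 z0 k1 decr qD; rewrite mulrA ler_pdivlMr //.
have : kappa * (1 + 2 * z) * P <= kappa * (1 + 2 * z) * (2 * (D - D')).
  have kz : 0 < kappa * (1 + 2 * z) by apply: mulr_gt0; lra.
  by rewrite ler_pM2l.
nra.
Qed.

Lemma iteration_progress_linear (kappa M D D' P z q : R) :
  0 < M -> 0 < D -> 0 < D' -> 0 < P -> 0 < z -> 0 < q -> q <= kappa ->
  1 <= kappa -> P <= 2 * (D - D') -> M ^+ 2 * P * (1 + z) = z ^+ 2 ->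
  2 * q * D <= kappa * P * (1 + 2 * z) ->
  expR (- (1 / 2)) * (3 / 2 + ln q)
  - expR (- (1 / 2)) * (3 / 2 + ln kappa) * (4 * M ^+ 2) * (D - D')
  <= 3 * kappa * ((D - D') / D).
Proof.
move=> M0 D0 D'0 P0 z0 q0 qk k1 decr PE qD.
have lk : 0 <= ln kappa by rewrite ln_ge0.
have lq : ln q <= ln kappa by rewrite ler_ln ?posrE //; lra.
have c0 := expR_gt0 (- (1 / 2) : R).
have r0 : 0 < (D - D') / D by rewrite divr_gt0 //; lra.
have Dd : 0 < D - D' by lra.
have MM : 0 < M ^+ 2 by rewrite exprn_gt0.
have [z1|z1] := leP z 1.
  have : 0 <= expR (- (1 / 2)) * (3 / 2 + ln kappa) * (4 * M ^+ 2) * (D - D').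
    by rewrite !mulr_ge0 ?ltW //; lra.
  have := tangent_ln q0; have := efficient_iteration D0 z0 k1 decr qD.
  have : kappa * (1 + 2 * z) * ((D - D') / D) <= 3 * kappa * ((D - D') / D).
    by rewrite ler_pM2r //; nra.
  lra.
(* For [z > 1] the relation [PE] forces [M^2 P >= 1 / 2], so the decrease of [D] alone pays for the
   whole term [3 / 2 + ln kappa]. *)
have big : 1 <= 4 * M ^+ 2 * (D - D').
  have : M ^+ 2 * P <= M ^+ 2 * (2 * (D - D')) by rewrite ler_pM2l.
  have : 1 <= 2 * (M ^+ 2 * P); last by lra.
  by move: (M ^+ 2 * P) PE => X PE'; nra.
have : expR (- (1 / 2)) * (3 / 2 + ln q) <=
  expR (- (1 / 2)) * (3 / 2 + ln kappa) * (4 * M ^+ 2 * (D - D')).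
  apply: le_trans (_ : expR (- (1 / 2)) * (3 / 2 + ln kappa) * 1 <= _).
    by rewrite mulr1 ler_pM2l // lerD2l.
  by rewrite ler_wpM2l // mulr_ge0 ?ltW //; lra.
have : 0 <= 3 * kappa * ((D - D') / D) by apply: mulr_ge0; [lra|exact: ltW].
rewrite !mulrA; lra.
Qed.

Lemma iteration_progress_sqrt (kappa M D D' P z q : R) :
  0 < M -> 0 < D -> 0 < D' -> 0 < P -> 0 < z -> 0 < q -> q <= kappa ->
  1 <= kappa -> P <= 2 * (D - D') -> M ^+ 2 * P * (1 + z) = z ^+ 2 ->
  2 * q * D <= kappa * P * (1 + 2 * z) ->
  expR (- (1 / 2)) * (3 / 2 + ln q)
  - 4 * Num.sqrt 2 * kappa * M * (Num.sqrt D - Num.sqrt D')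
  <= 3 * kappa * ((D - D') / D).
Proof.
move=> M0 D0 D'0 P0 z0 q0 qk k1 decr PE qD.
apply: le_trans (_ : q - 4 * Num.sqrt 2 * kappa * M * (Num.sqrt D - Num.sqrt D') <= _).
  by rewrite lerD2r tangent_ln.
have r0 : 0 < (D - D') / D by rewrite divr_gt0 //; lra.
have DD : D' < D by lra.
have s2 : 0 < Num.sqrt 2 :> R by rewrite sqrtr_gt0.
have hh : Num.sqrt D' <= Num.sqrt D by rewrite ler_sqrt // ltW.
have h0 : 0 < Num.sqrt D by rewrite sqrtr_gt0.
have h'0 : 0 < Num.sqrt D' by rewrite sqrtr_gt0.
have hD : Num.sqrt D ^+ 2 = D by rewrite sqr_sqrtr // ltW.
have hD' : Num.sqrt D' ^+ 2 = D' by rewrite sqr_sqrtr // ltW.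
have eff := efficient_iteration D0 z0 k1 decr qD.
have b0 : 0 < 4 * Num.sqrt 2 * kappa * M by rewrite !mulr_gt0 //; lra.
have [z1|z1] := leP z 1.
  have : kappa * (1 + 2 * z) * ((D - D') / D) <= 3 * kappa * ((D - D') / D).
    by rewrite ler_pM2r //; nra.
  have : 0 <= 4 * Num.sqrt 2 * kappa * M * (Num.sqrt D - Num.sqrt D').
    by rewrite mulr_ge0 ?subr_ge0 // ltW.
  lra.
have z2 : 0 < 1 + 2 * z by lra.
(* [efficient_iteration] guarantees a progress of at least [3 q / (1 + 2 z)]; [a] is the part of [q]
   that this leaves uncovered. *)
pose a := q * (2 * (z - 1)) / (1 + 2 * z).
have a0 : 0 <= a by rewrite !mulr_ge0 ?invr_ge0 ?(ltW z2) ?(ltW q0) //; lra.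
have aE : q - 3 * kappa * ((D - D') / D) <= a.
  have : 3 * (q / (1 + 2 * z)) <= 3 * kappa * ((D - D') / D).
    rewrite -[leRHS]mulrA ler_pM2l // ler_pdivrMr //; lra.
  have -> : a = q - 3 * (q / (1 + 2 * z)) by rewrite /a; field; rewrite gt_eqF.
  lra.
suff : a <= 4 * Num.sqrt 2 * kappa * M * (Num.sqrt D - Num.sqrt D') by lra.
(* From [D - D' >= P / 2] and [sqrt D + sqrt D' <= 2 sqrt D]. *)
have hdiff : P / (4 * Num.sqrt D) <= Num.sqrt D - Num.sqrt D'.
  rewrite ler_pdivrMr ?mulr_gt0 //; nra.
apply: le_trans (_ : 4 * Num.sqrt 2 * kappa * M * (P / (4 * Num.sqrt D)) <= _);
  last by rewrite ler_pM2l.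
have -> : 4 * Num.sqrt 2 * kappa * M * (P / (4 * Num.sqrt D)) =
  Num.sqrt 2 * (kappa * M * P) / Num.sqrt D by field; rewrite gt_eqF.
rewrite ler_pdivlMr // -ler_sqr ?nnegrE; last 2 first.
- by rewrite mulr_ge0 // ltW.
- by rewrite !mulr_ge0 ?ltW //; lra.
rewrite [(a * _) ^+ 2]exprMn hD [(Num.sqrt 2 * _) ^+ 2]exprMn.
rewrite (sqr_sqrtr (ler0n R 2)).
have zP : (z - 1) ^+ 2 <= M ^+ 2 * P * (1 + 2 * z).
  have z3 : 0 < 1 + z by lra.
  rewrite -(ler_pM2r z3) [leRHS]mulrAC PE; nra.
have qq : q * (2 * q * D) <= kappa * (kappa * P * (1 + 2 * z)).
  by rewrite ler_pM // ?mulr_ge0 ?ltW.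
(* The square is split so that [qq] and [zP] each bring one factor [1 + 2 z], cancelling the
   denominator. *)
have -> : a ^+ 2 * D =
    q * (2 * q * D) * (2 * ((z - 1) ^+ 2 / (1 + 2 * z) ^+ 2)).
  by rewrite /a; field; rewrite gt_eqF.
apply: le_trans (_ : kappa * (kappa * P * (1 + 2 * z)) *
  (2 * (M ^+ 2 * P * (1 + 2 * z) / (1 + 2 * z) ^+ 2)) <= _).
  have v2 : 0 < ((1 + 2 * z) ^+ 2)^-1 by rewrite invr_gt0 exprn_gt0.
  apply: ler_pM => //.
  - by rewrite !mulr_ge0 ?(ltW q0) ?(ltW D0).
  - by rewrite mulr_ge0 // mulr_ge0 ?sqr_ge0 // ltW.
  - by rewrite ler_pM2l // ler_pM2r.
rewrite le_eqVlt; apply/orP; left; apply/eqP; field.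
by rewrite gt_eqF.
Qed.
(** [V] is a potential whose decrease absorbs the error of each iteration, so the errors telescope
    to at most [V 0]. The ratio [D k / D 0] is a product of factors [1 - r], each at most
    [exp (- r)], and the sum of the relative decreases [r] is bounded below by [step]. *)
Lemma geometric_decrease (D q V : nat -> R) (kappa Psi0 : R) (k : nat) :
  0 < kappa -> (forall i, 0 < D i) ->
  (forall i, expR (- (1 / 2)) * (3 / 2 + ln (q i)) - (V i - V i.+1)
     <= 3 * kappa * ((D i - D i.+1) / D i)) ->
  - Psi0 <= \sum_(i < k) ln (q i) -> 0 <= V k ->
  D k <= D 0%N * expR (- ((expR (- (1 / 2)) * (3 / 2 * k%:R - Psi0) - V 0%N)
                        / (3 * kappa))).
Proof.
move=> k0 D0 step sumq Vk.
have k3 : 0 < 3 * kappa by rewrite mulr_gt0.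
have prod j : D j <= D 0%N * expR (- \sum_(i < j) (D i - D i.+1) / D i).
  elim: j => [|j IH]; first by rewrite big_ord0 oppr0 expR0 mulr1.
  rewrite big_ord_recr /= opprD expRD mulrA.
  have e : D j.+1 = D j * (1 - (D j - D j.+1) / D j).
    by field; rewrite gt_eqF.
  rewrite [leLHS]e.
  apply: ler_pM => //; first exact: ltW.
    have -> : 1 - (D j - D j.+1) / D j = D j.+1 / D j.
      by field; rewrite gt_eqF.
    by rewrite divr_ge0 // ltW.
  exact: expR_ge1Dx.
have sum j : expR (- (1 / 2)) * (3 / 2 * j%:R + \sum_(i < j) ln (q i))
    - (V 0%N - V j) <= 3 * kappa * \sum_(i < j) ((D i - D i.+1) / D i).
  elim: j => [|j IH]; first by rewrite !big_ord0 subrr; lra.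
  rewrite !big_ord_recr /= -[j.+1%:R]natr1; have := step j.
  move: (expR _) (ln _) IH => c l; lra.
apply: le_trans (prod k) _; rewrite ler_pM2l // ler_expR lerN2.
rewrite ler_pdivrMr // [leRHS]mulrC; apply: le_trans (sum k).
have c0 := expR_gt0 (- (1 / 2) : R).
have : expR (- (1 / 2)) * - Psi0 <= expR (- (1 / 2)) * \sum_(i < k) ln (q i).
  by rewrite ler_pM2l.
lra.
Qed.

(* The rate [1 - 1 / (6 kappa)] comes from [3 / 5 <= exp (- 1 / 2)] and
   [exp (- 6 x / 5) <= 1 - x]. *)
Lemma exp_le_rate (kappa a b e : R) : 1 <= kappa -> a <= b -> 0 <= a ->
  3 / 5 * b <= e ->
  expR (- (e / (3 * kappa))) <= (1 - 1 / (6 * kappa)) `^ a.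
Proof.
move=> k1 ab a0 be; have k0 : 0 < kappa by lra.
have x0 : 0 <= 1 / (6 * kappa) <= 1 / 6.
  rewrite divr_ge0 ?mulr_ge0 ?(ltW k0) //= ler_pdivrMr ?mulr_gt0 //; lra.
have /andP[_ x6] := x0.
have p0 : 0 < 1 - 1 / (6 * kappa) by lra.
rewrite -[leRHS]lnK ?posrE ?powR_gt0 // ler_expR ln_powR.
have := ler_wpM2l a0 (ln_onem_ge x0).
have -> : - (6 / 5) * (1 / (6 * kappa)) = - (3 / 5 / (3 * kappa)).
  by field; rewrite gt_eqF.
apply: le_trans; rewrite mulrN lerN2 mulrA ler_pM2r ?invr_gt0 ?mulr_gt0 //; lra.
Qed.

End Scalar.

(** * One iteration *)

(** With [a = 1 / L], the scaled matrices [B / L] follow the same update with [y / L], so that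
    [Psi_update] applies to them. *)
Lemma bfgs_updateZ (R : realType) n (a : R) (B : 'M[R]_n) (s y : 'cV[R]_n) :
  a != 0 -> a *: bfgs_update B s y = bfgs_update (a *: B) s (a *: y).
Proof.
move=> a0; rewrite /bfgs_update scalerDr scalerBr !scalerA; congr (_ - _ + _).
  rewrite -scalemxAr -!scalemxAl dotvZr !scalerA invfM; congr (_ *: _).
  by move: (dotv s _)^-1 => w; field.
rewrite linearZ /= -scalemxAl -scalemxAr dotvZl !scalerA invfM; congr (_ *: _).
by move: (dotv y s)^-1 => w; field.
Qed.

(** With [a = G / (L rho)] and [b = Y / (t rho)], the change of [Psi] is [w - a - ln b].
    Cocoercivity gives [w <= 1], and [1 - a <= - ln a] leaves [- ln (a b)], the logarithm of [q]. *)
Lemma Psi_bfgs_update (R : realType) n (L rho t : R) (B : 'M[R]_n)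
    (g d y : 'cV[R]_n) :
  0 < L -> 0 < t -> 0 < rho -> posdef B -> B *m d = - g -> g != 0 ->
  rho = - dotv g d -> 0 < dotv y d -> dotv y y <= L * (t * dotv y d) ->
  Psi (L^-1 *: bfgs_update B (t *: d) y) <=
  Psi (L^-1 *: B) + ln (L * t * rho ^+ 2 / (dotv g g * dotv y d)).
Proof.
move=> L0 t0 r0 pB Bd g0 rE Y0 yy.
have Li : 0 < L^-1 by rewrite invr_gt0.
have G0 := dotv_gt0 g0.
have Ln0 : L^-1 != 0 by rewrite gt_eqF.
rewrite bfgs_updateZ // Psi_update; last 2 first.
- exact: posdefZ.
- by rewrite dotvZl dotvZr !mulr_gt0.
have BsE : L^-1 *: B *m (t *: d) = - (L^-1 * t) *: g.
  by rewrite -scalemxAl -scalemxAr Bd scalerA scalerN scaleNr.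
have -> : dotv (t *: d) (L^-1 *: B *m (t *: d)) = t ^+ 2 / L * rho.
  by rewrite BsE dotvZl dotvZr dotvC rE; field; rewrite gt_eqF.
have -> : dotv (L^-1 *: B *m (t *: d)) (L^-1 *: B *m (t *: d)) =
    (t / L) ^+ 2 * dotv g g.
  by rewrite BsE dotvZl dotvZr; field; rewrite gt_eqF.
rewrite !dotvZl !dotvZr.
move: (dotv y y) (dotv y d) (dotv g g) Y0 G0 yy => Z Y G Y0 G0 yy {rE Bd g0 BsE}.
have -> : (t / L) ^+ 2 * G / (t ^+ 2 / L * rho) = G / (L * rho).
  by field; rewrite !gt_eqF.
have -> : L^-1 * (t * Y) / (t ^+ 2 / L * rho) = Y / (t * rho).
  by field; rewrite !gt_eqF.
have le1 : L^-1 * (L^-1 * Z) / (L^-1 * (t * Y)) <= 1.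
  rewrite ler_pdivrMr ?mulr_gt0 // mul1r ler_pM2l // ler_pdivrMl //.
have -> : L * t * rho ^+ 2 / (G * Y) = (G / (L * rho))^-1 * (Y / (t * rho))^-1.
  by field; rewrite !gt_eqF.
have a0 : 0 < G / (L * rho) by rewrite divr_gt0 ?mulr_gt0.
have b0 : 0 < Y / (t * rho) by rewrite divr_gt0 ?mulr_gt0.
move: (G / _) (Y / _) a0 b0 => a b a0 b0.
rewrite lnM ?posrE ?invr_gt0 // !lnV ?posrE //.
have := expR_ge1Dx (ln a); rewrite lnK ?posrE //.
move: (ln a) (ln b) (_ / (L^-1 * (t * Y))) le1 => la lb w.
move: (Psi _) => psi; lra.
Qed.

Lemma bfgs_iteration (R : realType) n (mu L M : R) (f : 'cV[R]_n -> R)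
    (xs x : 'cV[R]_n) (B : 'M[R]_n) :
  0 < mu -> 0 < L -> 0 < M -> Ck 3 f -> strongly_convex mu f ->
  lipschitz_grad L f -> self_concordant M f -> posdef B -> grad f x != 0 ->
  let d := bfgs_dir f x B in
  let s := adaptive_step M f x d *: d in
  let B' := bfgs_update B s (grad f (x + s) - grad f x) in
  posdef B' /\ exists P z q, [/\ 0 < P, 0 < z & 0 < q] /\
    [/\ q <= L / mu, P <= 2 * (f x - f (x + s)),
        M ^+ 2 * P * (1 + z) = z ^+ 2,
        2 * q * (f x - f xs) <= L / mu * P * (1 + 2 * z)
      & Psi (L^-1 *: B') <= Psi (L^-1 *: B) + ln q].
Proof.
move=> mu0 L0 M0 C3 sc lip self pB g0 d s B'.
have C1 : Ck 1 f by do 2!apply: Ck_le.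
have Bd : B *m d = - grad f x.
  by rewrite /d /bfgs_dir mulmxN mulmxA mulmxV ?mul1mx ?posdef_unit.
rewrite /B' /s; move: d Bd {s B'} => d Bd.
have d0 : d != 0.
  by apply: contra g0 => /eqP e; rewrite -oppr_eq0 -Bd e mulmx0.
have rho0 : 0 < - dotv (grad f x) d by rewrite dotvC -dotvNr -Bd pB.2.
have tE := adaptive_stepE f M x d.
have t0 := adaptive_step_gt0 mu0 M0 C3 sc d0 rho0.
have decr := adaptive_step_decrease mu0 M0 C3 sc self d0 rho0.
have curv := adaptive_step_curvature mu0 M0 C3 sc self d0 rho0.
have h0 := hnorm_gt0 mu0 C3 sc d0 x.
move: (hnorm f x d) (adaptive_step M f x d) h0 tE t0 decr curv => h t h0.
move rE : (- dotv (grad f x) d) rho0 => rho rho0 tE t0 decr curv.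
have mono := grad_strongly_monotone x (t *: d) C1 sc.
have coco := cocoercive x (t *: d) mu0 L0 C1 sc lip.
have domi := gradient_dominated x xs mu0 C1 sc.
move: (grad f (x + t *: d) - grad f x) curv mono coco => y.
rewrite !dotvZr dotvZl => curv mono coco.
have CS := dotv_CS (grad f x) d.
have G0 := dotv_gt0 g0; have E0 := dotv_gt0 d0.
rewrite -sqrrN rE in CS.
have z0 : 0 < M * (rho / h) by rewrite mulr_gt0 ?divr_gt0.
have z2 : 0 < 1 + 2 * (M * (rho / h)) by rewrite addr_gt0 // mulr_gt0.
have Y0 : 0 < dotv y d.
  by have := lt_le_trans rho0 curv; rewrite pmulr_lgt0.
split; first by apply: posdef_update => //; rewrite dotvZr mulr_gt0.
exists (t * rho), (M * (rho / h)).
exists (L * t * rho ^+ 2 / (dotv (grad f x) (grad f x) * dotv y d)).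
have psi := Psi_bfgs_update L0 t0 rho0 pB Bd g0 (esym rE) Y0 coco.
have p0 : 0 < h + M * rho by rewrite addr_gt0 // mulr_gt0.
move: (dotv (grad f x) _) (dotv d d) (dotv y d) G0 E0 Y0 CS mono curv domi psi.
move=> G E Y G0 E0 Y0 CS mono curv domi psi.
split; [split => // | split => //].
- exact: mulr_gt0.
- by rewrite divr_gt0 ?mulr_gt0 ?exprn_gt0.
(* [q <= kappa]: Cauchy-Schwarz gives [rho^2 <= G E], and strong monotonicity gives
   [mu t E <= Y]. *)
- rewrite ler_pdivrMr ?mulr_gt0 //.
  rewrite mulrCA ler_pM2l // in mono.
  apply: le_trans (_ : L * t * (G * E) <= _); first by rewrite ler_pM2l ?mulr_gt0.
  have -> : L * t * (G * E) = L / mu * (G * (mu * (t * E))).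
    by field; rewrite gt_eqF.
  by rewrite ler_pM2l ?divr_gt0 // ler_pM2l.
- by move: decr; lra.
- rewrite tE; field.
  by rewrite !gt_eqF.
(* Up to the factor [L t rho / (mu Y)], the left side is at most [rho] by gradient domination, and
   [rho] is at most [Y (1 + 2 z)] by the curvature bound. *)
- have -> : L / mu * (t * rho) * (1 + 2 * (M * (rho / h))) =
     L * t * rho / (mu * Y) * (Y * (1 + 2 * (M * (rho / h)))).
    by field; rewrite !gt_eqF.
  have c0 : 0 < L * t * rho / (mu * Y) by rewrite divr_gt0 ?mulr_gt0.
  apply: le_trans (_ : L * t * rho / (mu * Y) * rho <= _); last by rewrite ler_pM2l.
  have -> : 2 * (L * t * rho ^+ 2 / (G * Y)) * (f x - f xs) =
     L * t * rho / (mu * Y) * rho / G * (2 * mu * (f x - f xs)).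
    by field; rewrite !gt_eqF.
  rewrite -[leRHS](divfK (lt0r_neq0 G0)).
  by rewrite ler_pM2l // divr_gt0 // mulr_gt0.
Qed.

(** * Summation over the iterations and the convergence rate *)

Theorem theorem1 (R : realType) (n : nat) (mu L M : R) (f : 'cV[R]_n -> R)
    (xs x0 : 'cV[R]_n) (B0 : 'M[R]_n)
    (x : nat -> 'cV[R]_n) (B : nat -> 'M[R]_n)
    (hmu : 0 < mu) (hL : 0 < L) (hM : 0 < M)
    (hC3 : Ck 3 f)
    (hsc : strongly_convex mu f)
    (hlip : lipschitz_grad L f)
    (hself : self_concordant M f)
    (hmin : forall y : 'cV[R]_n, f xs <= f y)
    (hB0 : posdef B0)
    (halg : adaptive_BFGS M f x0 B0 x B)
    (hgrad : forall k : nat, grad f (x k) != 0) :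
  let kappa := L / mu in
  let Delta := f x0 - f xs in
  let K1 := 4 * M ^+ 2 * Delta in
  let K2 := 4 * Num.sqrt (2 * kappa) * M * Num.sqrt Delta in
  let m := Num.min ((2 * ln kappa + 1) * K1) (2 * Num.sqrt kappa * K2) in
  let K3 := m / Num.min (2 * ln kappa + 1) 2 in
  forall k : nat, 2 * Psi (L^-1 *: B0) + m <= k%:R ->
    (f (x k) - f xs) / (f x0 - f xs) <= (1 - 1 / (6 * kappa)) `^ (k%:R - K3).
Proof.
move=> kappa Delta K1 K2 m K3 k hk.
have C1 : Ck 1 f by do 2!apply: Ck_le.
(* The initial gradient supplies a nonzero vector; the lower and upper quadratic bounds along it
   force [mu <= L]. *)
have kappa1 : 1 <= kappa.
  have w0 := dotv_gt0 (hgrad 0%N).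
  have := strongly_convex_lower (x 0%N) (grad f (x 0%N)) C1 hsc.
  have := lipschitz_grad_upper (x 0%N) (grad f (x 0%N)) hL C1 hlip.
  move=> up /le_trans /(_ up); rewrite lerD2l ler_pM2r // => le.
  by rewrite /kappa ler_pdivlMr //; lra.
have kappa0 : 0 < kappa by lra.
case: halg => x0E B0E alg.
have posB i : posdef (B i).
  elim: i => [|i IH]; first by rewrite B0E.
  have [xE ->] := alg i; rewrite xE.
  by have [] := bfgs_iteration xs hmu hL hM hC3 hsc hlip hself IH (hgrad i).
pose D i := f (x i) - f xs.
have iter i : exists P z q, [/\ 0 < P, 0 < z & 0 < q] /\
    [/\ q <= kappa, P <= 2 * (D i - D i.+1), M ^+ 2 * P * (1 + z) = z ^+ 2,
        2 * q * D i <= kappa * P * (1 + 2 * z)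
      & Psi (L^-1 *: B i.+1) <= Psi (L^-1 *: B i) + ln q].
  have [xE BE] := alg i; rewrite /D BE xE.
  have [_] := bfgs_iteration xs hmu hL hM hC3 hsc hlip hself (posB i) (hgrad i).
  move=> [P [z [q [? []]]]] *; exists P, z, q; split=> //; split=> //.
  by rewrite opprB addrA subrK.
(* Strict positivity comes from the strict decrease at step [i], as [D i.+1] is nonnegative. *)
have D0 i : 0 < D i.
  have [P [z [q [[P0 _ _] [_ h _ _ _]]]]] := iter i.
  by have : 0 <= D i.+1; [rewrite /D subr_ge0 | lra].
have Dl0 : D 0%N = Delta by rewrite /D x0E.
rewrite -/Delta -/(D k).
clearbody kappa Delta D.
have step i : exists q, [/\ Psi (L^-1 *: B i.+1) <= Psi (L^-1 *: B i) + ln q,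
    expR (- (1 / 2)) * (3 / 2 + ln q)
    - expR (- (1 / 2)) * (3 / 2 + ln kappa) * (4 * M ^+ 2) * (D i - D i.+1)
    <= 3 * kappa * ((D i - D i.+1) / D i) &
    expR (- (1 / 2)) * (3 / 2 + ln q)
    - 4 * Num.sqrt 2 * kappa * M * (Num.sqrt (D i) - Num.sqrt (D i.+1))
    <= 3 * kappa * ((D i - D i.+1) / D i)].
  have [P [z [q [[P0 z0 q0] [qk h PE qD psi]]]]] := iter i.
  exists q; split=> //.
    exact: (iteration_progress_linear hM (D0 i) (D0 i.+1) P0 z0).
  exact: (iteration_progress_sqrt hM (D0 i) (D0 i.+1) P0 z0).
have /choice[q hq] := step.
have sumq : - Psi (L^-1 *: B0) <= \sum_(i < k) ln (q i).
  have : Psi (L^-1 *: B k) <= Psi (L^-1 *: B0) + \sum_(i < k) ln (q i).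
    elim: (k) => [|j IH]; first by rewrite B0E big_ord0 addr0.
    by rewrite big_ord_recr /= addrA; have [+ _ _] := hq j; lra.
  have Li : 0 < L^-1 by rewrite invr_gt0.
  have := Psi_ge0 (posdefZ Li (posB k)); lra.
have psi0 : 0 <= Psi (L^-1 *: B0).
  by apply/Psi_ge0/posdefZ; rewrite ?invr_gt0.
have Delta0 : 0 < Delta by rewrite -Dl0.
rewrite ler_pdivrMr // [leRHS]mulrC -Dl0.
have lk : 0 <= ln kappa by rewrite ln_ge0.
have c0 := expR_gt0 (- (1 / 2) : R); have c35 := @expRN_half_ge R.
have K10 : 0 <= K1 by rewrite /K1 !mulr_ge0 ?sqr_ge0 // ltW.
have K20 : 0 <= K2 by rewrite /K2 !mulr_ge0 ?sqrtr_ge0 // ltW.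
have mn0 : 0 < Num.min (2 * ln kappa + 1) 2 by rewrite lt_min; apply/andP; split; lra.
have mn1 : 1 <= Num.min (2 * ln kappa + 1) 2 by rewrite le_min; apply/andP; split; lra.
have m0 : 0 <= m by rewrite /m le_min !mulr_ge0 ?sqrtr_ge0 //; lra.
(* The denominator of [K3] is at least 1, hence [K3 <= m <= k]; [exp_le_rate] requires a nonnegative
   exponent. *)
have K3k : 0 <= k%:R - K3.
  have : K3 <= m by rewrite /K3 ler_pdivrMr // ler_peMr.
  lra.
(* The potential [V] is a multiple of [D] or of [sqrt D], according to which term attains the
   minimum [m]; [b] is the exponent obtained with it, at least [k - K3]. *)
suff [V [b [Vge0 stepV bK3 rate]]] : exists (V : nat -> R) b, [/\ 0 <= V k,
    forall i, expR (- (1 / 2)) * (3 / 2 + ln (q i)) - (V i - V i.+1)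
      <= 3 * kappa * ((D i - D i.+1) / D i), k%:R - K3 <= b &
    3 / 5 * b <=
      expR (- (1 / 2)) * (3 / 2 * k%:R - Psi (L^-1 *: B0)) - V 0%N].
  apply: le_trans (geometric_decrease kappa0 D0 stepV sumq Vge0) _.
  by rewrite ler_pM2l // (exp_le_rate kappa1 bK3).
have [le12|le21] := leP ((2 * ln kappa + 1) * K1) (2 * Num.sqrt kappa * K2).
- have mE : m = (2 * ln kappa + 1) * K1 by rewrite /m min_l.
  have K3le : K1 <= K3.
    by rewrite /K3 mE ler_pdivlMr // mulrC ler_wpM2r // ge_min lexx.
  exists (fun i => expR (- (1 / 2)) * (3 / 2 + ln kappa) * (4 * M ^+ 2) * D i).
  exists (k%:R - K1); split; last 1 first.
  + have -> : expR (- (1 / 2)) * (3 / 2 + ln kappa) * (4 * M ^+ 2) * D 0%N =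
        expR (- (1 / 2)) * ((3 / 2 + ln kappa) * K1) by rewrite Dl0 /K1; ring.
    rewrite -mulrBr.
    (* Half of the hypothesis on [k] reads [k / 2 >= Psi + (ln kappa + 1 / 2) K1]. *)
    have kK : k%:R - K1 <= 3 / 2 * k%:R - Psi (L^-1 *: B0) - (3 / 2 + ln kappa) * K1.
      by move: hk; rewrite mE; lra.
    have k0 : 0 <= k%:R - K1 by lra.
    by apply: ler_pM => //; lra.
  + by rewrite !mulr_ge0 ?sqr_ge0 ?(ltW c0) ?(ltW (D0 k)) //; lra.
  + by move=> i; have [_ + _] := hq i; rewrite mulrBr.
  + by rewrite lerD2l lerN2.
- have mE : m = 2 * Num.sqrt kappa * K2 by rewrite /m min_r // ltW.
  have K3le : Num.sqrt kappa * K2 <= K3.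
    rewrite /K3 mE ler_pdivlMr // mulrC -[leRHS]mulrA ler_wpM2r // ?ge_min ?lexx ?orbT //.
    by rewrite mulr_ge0 // sqrtr_ge0.
  exists (fun i => 4 * Num.sqrt 2 * kappa * M * Num.sqrt (D i)).
  exists (k%:R - Num.sqrt kappa * K2); split; last 1 first.
  + have -> : 4 * Num.sqrt 2 * kappa * M * Num.sqrt (D 0%N) = Num.sqrt kappa * K2.
      have e (a : R) : 0 <= a -> 4 * Num.sqrt 2 * a * M * Num.sqrt Delta =
          Num.sqrt a * (4 * Num.sqrt (2 * a) * M * Num.sqrt Delta).
        by move=> a0; rewrite sqrtrM // -{1}(sqr_sqrtr a0); ring.
      by rewrite Dl0 (e _ (ltW kappa0)).
    move: hk; rewrite mE -mulrA; have : 0 <= Num.sqrt kappa * K2.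
      by rewrite mulr_ge0 // sqrtr_ge0.
    move: (Num.sqrt kappa * K2) => A A0 hk'.
    (* Here [k / 2 >= Psi + A]. The potential starts at [A], without the factor [exp (- 1 / 2)]; the
       surplus [A] pays for it because [3 / 5 (k + A) - A >= 3 / 5 (k - A)]. *)
    have kA : k%:R + A <= 3 / 2 * k%:R - Psi (L^-1 *: B0) by lra.
    have kA0 : 0 <= k%:R + A by rewrite addr_ge0.
    have : 3 / 5 * (k%:R + A) <=
        expR (- (1 / 2)) * (3 / 2 * k%:R - Psi (L^-1 *: B0)).
      by apply: ler_pM => //; lra.
    lra.
  + by rewrite !mulr_ge0 ?sqrtr_ge0 ?(ltW kappa0) ?(ltW hM).
  + by move=> i; have [_ _] := hq i; rewrite mulrBr.
  + by rewrite lerD2l lerN2.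
Qed.
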